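(* Let $T$ be a locally Krull-minimal theory. Then the class of models of $T$ has the amalgamation property over sets: whenever $M$ and $N$ are models of $T$ and $A=M\cap N$ is a substructure of both, there exist a model $N'$ of $T$ containing $N$ and an embedding $f:M\to N'$ which is the identity on $A$.
   Context: $T$ is a consistent first-order theory such that every model of $T$ is contained in an infinite one and $T$ is complete for quantifier-free sentences; ''model'' means model of $T$. For an $A$-type $q(z)$, $\vdash_A q(z)$ means $\forall z\,q(z)$ holds in every model containing the substructure generated by $A$; $p\vdash_A q$ abbreviates $\vdash_A p\rightarrow q$. An equational formula is a quantifier-free formula built from atomic formulas, $\top,\bot$ using only $\wedge,\vee$; an equational type is a set of such formulas. An $A$-type $p(z)$ is trivial over $A$ if $\vdash_A p(z)$; consistent over $A$ if $\nvdash_A\neg p(z)$; maximal over $A$ if consistent over $A$ and for every equational $A$-formula $\varphi$, $p\vdash_A\varphi$ or $p\vdash_A\neg\varphi$; prime over $A$ if consistent over $A$ and $p\vdash_A\varphi\vee\psi$ implies $p\vdash_A\varphi$ or $p\vdash_A\psi$ for equational $A$-formulas $\varphi,\psi$; principal over $A$ if there is an $A$-formula $\varphi(z)$ with $\vdash_A p(z)\leftrightarrow\varphi(z)$. $T$ is locally Krull-minimal if for every finite tuple $a$ and single variable $x$: (D0) the trivial type $x=x$ is prime over $a$; (D1) for every equational formula $\zeta(a,x)$ consistent over $a$ there is a quantifier-free formula $\vartheta(z)$ with $\vdash_a\vartheta(a)$ such that $\zeta(b,x)$ is consistent over $b$ for every $b$ with $\vdash_b\vartheta(b)$; (D2) every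 equational formula $\zeta(a,x)$ consistent over $a$ is consistent over any $B$ containing $a$; (D3) every non-trivial prime equational type $p(a,x)$ over $a$ is maximal and principal over $a$. *)

(* Defs.v *)
From mathcomp Require Import all_boot.
From mathcomp Require Import boolp classical_sets cardinality.

Set Implicit Arguments.
Unset Strict Implicit.
Unset Printing Implicit Defensive.

Local Open Scope classical_set_scope.

Record language := Language {
  func_sym : Type;
  farity : func_sym -> nat;
  rel_sym : Type;
  rarity : rel_sym -> nat }.

Inductive term (L : language) (V : Type) : Type :=
| Var of V
| App (f : func_sym L) of ('I_(farity f) -> term L V).

(* [formula L V]: formulas with free variables in V; a quantifier binds the   *)
(* extra variable [None] of [option V].                                       *)
Inductive formula (L : language) (V : Type) : Type :=
| Top
| Bot
| Eq of term L V & term L V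
| Rel (r : rel_sym L) of ('I_(rarity r) -> term L V)
| Not of formula L V
| And of formula L V & formula L V
| Or of formula L V & formula L V
| All of formula L (option V)
| Ex of formula L (option V).

Arguments Var {L V}.
Arguments App {L V}.
Arguments Top {L V}.
Arguments Bot {L V}.
Arguments Eq {L V}.
Arguments Rel {L V}.
Arguments Not {L V}.
Arguments And {L V}.
Arguments Or {L V}.
Arguments All {L V}.
Arguments Ex {L V}.

Fixpoint quantifier_free (L : language) (V : Type) (phi : formula L V) : bool :=
  match phi with
  | Top | Bot | Eq _ _ | Rel _ _ => true
  | Not psi => quantifier_free psi
  | And psi chi | Or psi chi => quantifier_free psi && quantifier_free chi
  | All _ | Ex _ => false
  end.

Fixpoint equational (L : language) (V : Type) (phi : formula L V) : bool :=
  match phi with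
  | Top | Bot | Eq _ _ | Rel _ _ => true
  | And psi chi | Or psi chi => equational psi && equational chi
  | Not _ | All _ | Ex _ => false
  end.

Fixpoint rename_term (L : language) (V W : Type) (s : V -> W)
    (t : term L V) : term L W :=
  match t with
  | Var x => Var (s x)
  | App f ts => App f (fun i => rename_term s (ts i))
  end.

Fixpoint rename (L : language) (V W : Type) (s : V -> W)
    (phi : formula L V) : formula L W :=
  match phi with
  | Top => Top
  | Bot => Bot
  | Eq t u => Eq (rename_term s t) (rename_term s u)
  | Rel r ts => Rel r (fun i => rename_term s (ts i))
  | Not psi => Not (rename s psi)
  | And psi chi => And (rename s psi) (rename s chi)
  | Or psi chi => Or (rename s psi) (rename s chi)
  | All psi => All (rename (omap s) psi)
  | Ex psi => Ex (rename (omap s) psi)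
  end.

(* The carrier may be empty, so that the substructure generated by the empty  *)
(* set always makes sense; models are required to be nonempty, see [model].   *)
Record structure (L : language) := Structure {
  carrier :> Type;
  fint : forall f : func_sym L, ('I_(farity f) -> carrier) -> carrier;
  rint : forall r : rel_sym L, ('I_(rarity r) -> carrier) -> Prop }.

Fixpoint eval (L : language) (M : structure L) (V : Type) (v : V -> M)
    (t : term L V) : M :=
  match t with
  | Var x => v x
  | App f ts => fint (fun i => eval v (ts i))
  end.

Definition extend (T V : Type) (v : V -> T) (x : T) : option V -> T :=
  fun o => if o is Some y then v y else x.

Fixpoint sat (L : language) (M : structure L) (V : Type) (phi : formula L V) :
    (V -> M) -> Prop :=
  match phi with
  | Top => fun _ => True
  | Bot => fun _ => False
  | Eq t u => fun v => eval v t = eval v u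
  | Rel r ts => fun v => rint (fun i => eval v (ts i))
  | Not psi => fun v => ~ sat psi v
  | And psi chi => fun v => sat psi v /\ sat chi v
  | Or psi chi => fun v => sat psi v \/ sat chi v
  | All psi => fun v => forall x : M, sat psi (extend v x)
  | Ex psi => fun v => exists x : M, sat psi (extend v x)
  end.

Record embedding (L : language) (M N : structure L) := Embedding {
  emb_fun :> M -> N;
  emb_inj : injective emb_fun;
  emb_fint : forall (f : func_sym L) (u : 'I_(farity f) -> M),
    emb_fun (fint u) = fint (emb_fun \o u);
  emb_rint : forall (r : rel_sym L) (u : 'I_(rarity r) -> M),
    rint u <-> rint (emb_fun \o u) }.

Definition theory (L : language) : Type := set (formula L void).

Definition model (L : language) (T : theory L) (M : structure L) : Prop :=
  inhabited M /\ forall phi, T phi -> sat phi (of_void M).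

Definition consistent_theory (L : language) (T : theory L) : Prop :=
  exists M : structure L, model T M.

Definition complete_qf (L : language) (T : theory L) : Prop :=
  forall phi : formula L void, quantifier_free phi ->
    (forall M, model T M -> sat phi (of_void M)) \/
    (forall M, model T M -> sat (Not phi) (of_void M)).

Definition extends_to_infinite (L : language) (T : theory L) : Prop :=
  forall M, model T M -> exists N : structure L,
    [/\ model T N, infinite_set [set: N] & inhabited (embedding M N)].

Definition fint_closed (L : language) (M : structure L) : set (set M) :=
  [set X | forall (f : func_sym L) (u : 'I_(farity f) -> M),
    (forall i, X (u i)) -> X (fint u)].

Definition generated (L : language) (M : structure L) (A : set M) : set M :=
  smallest (@fint_closed L M) A.

Lemma generated_fint (L : language) (M : structure L) (A : set M)
    (f : func_sym L) (u : 'I_(farity f) -> {x : M | generated A x}) :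
  generated A (fint (fun i => sval (u i))).
Proof.
move=> X [clX AX]; apply: (clX) => i.
exact: (svalP (u i) X (conj clX AX)).
Qed.

Lemma sub_generated (L : language) (M : structure L) (A : set M) :
  A `<=` generated A.
Proof. exact: sub_smallest. Qed.

Definition gen_structure (L : language) (M : structure L) (A : set M) :
    structure L :=
  {| carrier := {x : M | generated A x};
     fint := fun f u => exist _ _ (generated_fint u);
     rint := fun r u => rint (fun i => sval (u i)) |}.

Definition param (L : language) (M : structure L) (A : set M) : Type :=
  {x : M | A x}.

Definition param_gen (L : language) (M : structure L) (A : set M)
    (c : param A) : gen_structure A :=
  exist _ (sval c) (sub_generated (svalP c)).

(* A-formulas in the variables Z: the summand [param A] holds the parameters. *)
Definition formula_over (L : language) (M : structure L) (A : set M)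
    (Z : Type) : Type := formula L (param A + Z).

Definition type_over (L : language) (M : structure L) (A : set M)
    (Z : Type) : Type := set (formula_over A Z).

Definition equational_type (L : language) (M : structure L) (A : set M)
    (Z : Type) (p : type_over A Z) : Prop :=
  forall phi, p phi -> equational phi.

Definition assign (L : language) (M N : structure L) (A : set M) (Z : Type)
    (e : embedding (gen_structure A) N) (z : Z -> N) : param A + Z -> N :=
  fun w => match w with inl c => e (param_gen c) | inr i => z i end.

Definition realizes (L : language) (M N : structure L) (A : set M) (Z : Type)
    (p : type_over A Z) (v : param A + Z -> N) : Prop :=
  forall phi, p phi -> sat phi v.

(* [vdash T A Q] is |-_A Q(z): Q holds of every tuple z of every model of T   *)
(* containing the substructure generated by A. The condition Q is given       *)
(* semantically because infinite types p occur in it as p -> q and as ~ p.    *)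
Definition vdash (L : language) (T : theory L) (M : structure L) (A : set M)
    (Z : Type) (Q : forall N : structure L, (param A + Z -> N) -> Prop) : Prop :=
  forall N : structure L, model T N ->
  forall (e : embedding (gen_structure A) N) (z : Z -> N), Q N (assign e z).

Arguments vdash {L} T {M} A {Z} Q.

Definition entails (L : language) (T : theory L) (M : structure L) (A : set M)
    (Z : Type) (p : type_over A Z) (phi : formula_over A Z) : Prop :=
  vdash T A (fun N v => realizes p v -> sat phi v).

Definition trivial_type (L : language) (T : theory L) (M : structure L)
    (A : set M) (Z : Type) (p : type_over A Z) : Prop :=
  vdash T A (fun N v => realizes p v).

Definition consistent_type (L : language) (T : theory L) (M : structure L)
    (A : set M) (Z : Type) (p : type_over A Z) : Prop :=
  ~ vdash T A (fun N v => ~ realizes p v).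

Definition maximal_type (L : language) (T : theory L) (M : structure L)
    (A : set M) (Z : Type) (p : type_over A Z) : Prop :=
  consistent_type T p /\
  forall phi : formula_over A Z, equational phi ->
    entails T p phi \/ entails T p (Not phi).

Definition prime_type (L : language) (T : theory L) (M : structure L)
    (A : set M) (Z : Type) (p : type_over A Z) : Prop :=
  consistent_type T p /\
  forall phi psi : formula_over A Z, equational phi -> equational psi ->
    entails T p (Or phi psi) -> entails T p phi \/ entails T p psi.

Definition principal_type (L : language) (T : theory L) (M : structure L)
    (A : set M) (Z : Type) (p : type_over A Z) : Prop :=
  exists phi : formula_over A Z,
    vdash T A (fun N v => realizes p v <-> sat phi v).

(* zeta(a, x), for a formula zeta(z, x) and a tuple a of elements of A *)
Definition inst (L : language) (M : structure L) (A : set M) (n : nat)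
    (Z : Type) (a : 'I_n -> param A) (zeta : formula L ('I_n + Z)) :
    formula_over A Z :=
  rename (fun w => match w with inl i => inl (a i) | inr x => inr x end) zeta.

(* vartheta(a), for a formula vartheta(z) without further variables *)
Definition inst0 (L : language) (M : structure L) (A : set M) (n : nat)
    (a : 'I_n -> param A) (theta : formula L 'I_n) : formula_over A void :=
  rename (fun i => inl (a i)) theta.

Definition tuple_param (L : language) (M : structure L) (n : nat)
    (a : 'I_n -> M) (i : 'I_n) : param (range a) :=
  exist _ (a i) (imageT a i).

Definition trivial_eq (L : language) (M : structure L) (A : set M) :
    type_over A unit :=
  [set Eq (Var (inr tt)) (Var (inr tt))].

Definition axiom_D0 (L : language) (T : theory L) (M : structure L) (n : nat)
    (a : 'I_n -> M) : Prop :=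
  prime_type T (@trivial_eq L M (range a)).

Definition axiom_D1 (L : language) (T : theory L) (M : structure L) (n : nat)
    (a : 'I_n -> M) : Prop :=
  forall zeta : formula L ('I_n + unit), equational zeta ->
    consistent_type T [set inst (tuple_param a) zeta] ->
  exists theta : formula L 'I_n,
    [/\ quantifier_free theta,
        trivial_type T [set inst0 (tuple_param a) theta] &
        forall K : structure L, model T K -> forall b : 'I_n -> K,
          trivial_type T [set inst0 (tuple_param b) theta] ->
          consistent_type T [set inst (tuple_param b) zeta]].

(* "B contains a": B is a set of elements of some model K containing the      *)
(* substructure generated by a, and the copy of a in K lies in B.             *)
Definition axiom_D2 (L : language) (T : theory L) (M : structure L) (n : nat)
    (a : 'I_n -> M) : Prop :=
  forall zeta : formula L ('I_n + unit), equational zeta ->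
    consistent_type T [set inst (tuple_param a) zeta] ->
  forall K : structure L, model T K ->
  forall (e : embedding (gen_structure (range a)) K) (B : set K)
    (aB : forall i, B (e (param_gen (tuple_param a i)))),
    consistent_type T [set inst (fun i => exist _ _ (aB i) : param B) zeta].

Definition axiom_D3 (L : language) (T : theory L) (M : structure L) (n : nat)
    (a : 'I_n -> M) : Prop :=
  forall p : type_over (range a) unit, equational_type p ->
    ~ trivial_type T p -> prime_type T p ->
    maximal_type T p /\ principal_type T p.

Definition locally_krull_minimal (L : language) (T : theory L) : Prop :=
  forall M : structure L, model T M -> forall (n : nat) (a : 'I_n -> M),
    [/\ axiom_D0 T a, axiom_D1 T a, axiom_D2 T a & axiom_D3 T a].

(* Main.v *)
(** The proof realizes, one element at a time, the quantifier-free type over a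
    finite tuple a of elements c of M in extensions of N, and concludes by
    compactness.  The equational type p of c over a is prime.  If p is
    non-trivial, then by (D3) it is isolated by an equational formula and
    determines the quantifier-free type, and (D2) realizes it over N.  If p is
    trivial, a generic element over a is needed in an extension of N.  The
    equational formulas over a that are valid in all extensions of N form a
    type q, which is prime by (D0) and compactness.  If q is trivial, a generic
    element exists by compactness.  Otherwise q is maximal; if a is nonempty, q
    decides x = a_0, which is impossible since N has infinite extensions; if a
    is empty, q is isolated by a formula that (D2) realizes in an extension of
    M, and this reduces the problem to a one-element tuple. *)

From mathcomp Require Import all_boot.
From mathcomp Require Import boolp classical_sets cardinality filter.
Require Import Defs.

Set Implicit Arguments.
Unset Strict Implicit.
Unset Printing Implicit Defensive.

Local Open Scope classical_set_scope.

(** * Renaming of variables *)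

Lemma eval_rename_term (L : language) (M : structure L) (V W : Type)
    (s : V -> W) (t : term L V) (v : W -> M) :
  eval v (rename_term s t) = eval (v \o s) t.
Proof.
by elim: t => [//|f ts IH] /=; congr fint; apply: funext => k; apply: IH.
Qed.

Lemma sat_rename (L : language) (M : structure L) (V : Type)
    (phi : formula L V) (W : Type) (s : V -> W) (v : W -> M) :
  sat (rename s phi) v = sat phi (v \o s).
Proof.
have ext_omap (V' W' : Type) (s' : V' -> W') (v' : W' -> M) x :
    extend v' x \o omap s' = extend (v' \o s') x.
  by apply: funext => -[y|].
elim: phi W s v => //= {V}.
- by move=> V t u W s v; rewrite !eval_rename_term.
- move=> V r ts W s v; congr rint; apply: funext => k.
  exact: eval_rename_term.
- by move=> V psi IH W s v; rewrite IH.
- by move=> V psi IH chi IH' W s v; rewrite IH IH'.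
- by move=> V psi IH chi IH' W s v; rewrite IH IH'.
- by move=> V psi IH W s v; apply: eq_forall => x; rewrite IH ext_omap.
- by move=> V psi IH W s v; apply: eq_exists => x; rewrite IH ext_omap.
Qed.

Lemma quantifier_free_rename (L : language) (V W : Type) (s : V -> W)
    (phi : formula L V) :
  quantifier_free (rename s phi) = quantifier_free phi.
Proof. by elim: phi W s => //= {}V psi IH chi IH' W s; rewrite IH IH'. Qed.

Lemma equational_rename (L : language) (V W : Type) (s : V -> W)
    (phi : formula L V) :
  equational (rename s phi) = equational phi.
Proof. by elim: phi W s => //= {}V psi IH chi IH' W s; rewrite IH IH'. Qed.

(** * Ultraproducts and compactness *)

Definition ultra_class (L : language) (I : Type) (U : set_system I)
    (K : I -> structure L) (f : forall i, K i) : set (forall i, K i) :=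
  [set g | U [set i | f i = g i]].

(** The quotient modulo agreement on a set of [U] is encoded as the type of its classes, each of
    them a set of functions. *)
Definition ultra_carrier (L : language) (I : Type) (U : set_system I)
    (K : I -> structure L) : Type :=
  {P : set (forall i, K i) | exists f, P = ultra_class U f}.

Definition ultra_proj (L : language) (I : Type) (U : set_system I)
    (K : I -> structure L) (f : forall i, K i) : ultra_carrier U K :=
  exist _ (ultra_class U f) (ex_intro _ f erefl).

Definition ultra_repr (L : language) (I : Type) (U : set_system I)
    (K : I -> structure L) (x : ultra_carrier U K) : forall i, K i :=
  sval (cid (svalP x)).

Definition ultraproduct (L : language) (I : Type) (U : set_system I)
    (K : I -> structure L) : structure L :=
  {| carrier := ultra_carrier U K;
     fint := fun f u =>
       ultra_proj U (fun i => @fint L (K i) f (fun k => ultra_repr (u k) i));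
     rint := fun r u =>
       U [set i | @rint L (K i) r (fun k => ultra_repr (u k) i)] |}.

Lemma ultra_reprK (L : language) (I : Type) (U : set_system I)
    (K : I -> structure L) (x : ultra_carrier U K) :
  ultra_proj U (ultra_repr x) = x.
Proof.
by rewrite /ultra_proj /ultra_repr; case: x => P e /=; apply: eq_exist;
  case: cid => f /= ->.
Qed.

Lemma ultra_projP (L : language) (I : Type) (U : set_system I)
    (FU : Filter U) (K : I -> structure L) (f g : forall i, K i) :
  ultra_proj U f = ultra_proj U g <-> U [set i | f i = g i].
Proof.
split=> [/(congr1 sval) /= e|fg].
  have : ultra_class U g g.
    by apply: (filterS _ (filterT : U setT)) => i _.
  by rewrite -e.
apply: eq_exist; apply/seteqP; split=> h hh; rewrite /ultra_class /= in hh *.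
  by apply: filterS (filterI fg hh) => i [/= <- <-].
by apply: filterS (filterI fg hh) => i [/= -> ->].
Qed.

Lemma ultra_repr_proj (L : language) (I : Type) (U : set_system I)
    (FU : Filter U) (K : I -> structure L) (f : forall i, K i) :
  U [set i | ultra_repr (ultra_proj U f) i = f i].
Proof. by apply/ultra_projP; rewrite ultra_reprK. Qed.

(** Arities are finite, so agreement at each argument of a symbol gives agreement at all its
    arguments on one set of [U]. *)
Lemma filter_forall_ord (I : Type) (U : set_system I) (FU : Filter U) (n : nat)
    (P : 'I_n -> set I) :
  (forall k, U (P k)) -> U [set i | forall k, P k i].
Proof.
move=> UP; suff: U [set i | forall k, k \in enum 'I_n -> P k i].
  by apply: filterS => i Pi k; apply: Pi; rewrite mem_enum.
elim: (enum 'I_n) => [|k s IH]; first exact: (filterS _ filterT).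
apply: filterS (filterI (UP k) IH) => i [Pk Ps] k'.
by rewrite inE => /orP[/eqP -> //|/Ps].
Qed.

Lemma eval_ultraproduct (L : language) (I : Type) (U : set_system I)
    (FU : Filter U) (K : I -> structure L) (V : Type) (t : term L V)
    (v : V -> forall i, K i) :
  eval (M := ultraproduct U K) (fun x => ultra_proj U (v x)) t =
  ultra_proj U (fun i => eval (fun x => v x i) t).
Proof.
elim: t => [//|f ts IH] /=; apply/ultra_projP.
have : U [set i | forall k,
    ultra_repr (ultra_proj U (fun j => eval (v^~ j) (ts k))) i =
    eval (v^~ i) (ts k)].
  by apply: filter_forall_ord => k; apply: ultra_repr_proj.
apply: filterS => i /= e; congr fint; apply: funext => k.
by rewrite IH e.
Qed.

Lemma ultra_setC (I : Type) (U : set_system I) (FU : UltraFilter U)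
    (A : set I) : U (~` A) <-> ~ U A.
Proof.
split=> [UnA UA|nUA]; last by case: (in_ultra_setVsetC A FU).
by have [i []] := filter_ex (filterI UA UnA).
Qed.

(** This is Los's theorem, by induction on the formula; negation and disjunction use that [U] is an
    ultrafilter. *)
Lemma sat_ultraproduct (L : language) (I : Type) (U : set_system I)
    (FU : UltraFilter U) (K : I -> structure L) (K0 : forall i, K i)
    (V : Type) (phi : formula L V) (v : V -> forall i, K i) :
  sat (M := ultraproduct U K) phi (fun x => ultra_proj U (v x)) <->
  U [set i | sat phi (fun x => v x i)].
Proof.
have ext_proj (W : Type) (w : W -> forall i, K i) f :
    extend (fun x => ultra_proj U (w x)) (ultra_proj U f) =
    fun x => ultra_proj U (extend w f x).
  by apply: funext => -[].
have ext_at (W : Type) (w : W -> forall i, K i) f i :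
    extend (w^~ i) (f i) = (extend w f)^~ i.
  by apply: funext => -[].
elim: phi v => {V} /=.
- by move=> V v; split=> // _; apply: (filterS _ (filterT : U setT)).
- by move=> V v; split=> // /filter_ex[].
- by move=> V t u v; rewrite !eval_ultraproduct; apply: ultra_projP.
- move=> V r ts v.
  have E : U [set i | forall k,
      ultra_repr (eval (M := ultraproduct U K)
        (fun x => ultra_proj U (v x)) (ts k)) i = eval (v^~ i) (ts k)].
    apply: filter_forall_ord => k; rewrite eval_ultraproduct.
    exact: ultra_repr_proj.
  split=> UR; apply: filterS (filterI E UR) => i [/= e].
    by under eq_fun do rewrite e.
  by under [in X in _ -> X]eq_fun do rewrite e.
- move=> V psi IH v; rewrite IH; exact: iff_sym (ultra_setC FU _).
- move=> V psi IH chi IH' v; rewrite IH IH'; split=> [[A B]|H].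
    exact: filterI.
  by split; apply: filterS H => i [].
- move=> V psi IH chi IH' v; rewrite IH IH'; split=> [[]|H].
  + by apply: filterS => i; left.
  + by apply: filterS => i; right.
  + apply: contrapT => /not_orP[/(ultra_setC FU _).2 A /(ultra_setC FU _).2 B].
    by have [i [[] ? [a b]]] := filter_ex (filterI H (filterI A B)).
- move=> V psi IH v; split=> [H|H x].
    apply: contrapT => /(ultra_setC FU _).2 H'.
    (* A counterexample in the ultraproduct is assembled from counterexamples in the factors where
       there is one, and from [K0 i] elsewhere. *)
    have exf : forall i, exists x : K i,
        ~ (forall y, sat psi (extend (v^~ i) y)) ->
        ~ sat psi (extend (v^~ i) x).
      move=> i; have [A|/existsNP[x nx]] :=
        pselect (forall y, sat psi (extend (v^~ i) y)); last by exists x.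
      by exists (K0 i).
    pose f i := sval (cid (exf i)); have Hf i := svalP (cid (exf i)).
    have := H (ultra_proj U f); rewrite ext_proj IH => H2.
    have [i [/= /Hf A B]] := filter_ex (filterI H' H2).
    by apply: A; rewrite (ext_at _ v f i).
  rewrite -(ultra_reprK x) ext_proj IH; apply: filterS H => i /= H.
  by rewrite -ext_at; apply: H.
- move=> V psi IH v; split=> [[x]|H].
    rewrite -(ultra_reprK x) ext_proj IH; apply: filterS => i /=.
    by rewrite -ext_at => ?; exists (ultra_repr x i).
  have exf : forall i, exists x : K i,
      (exists y, sat psi (extend (v^~ i) y)) -> sat psi (extend (v^~ i) x).
    move=> i; have [[x A]|A] :=
      pselect (exists y, sat psi (extend (v^~ i) y)); first by exists x.
    by exists (K0 i).
  pose f i := sval (cid (exf i)); have Hf i := svalP (cid (exf i)).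
  exists (ultra_proj U f); rewrite ext_proj IH; apply: filterS H => i /= /Hf.
  by rewrite (ext_at _ v f i).
Qed.

(** The indices are the finite lists of formulas from [Gamma]. For each list, take the set of lists
    containing it; these sets generate a proper filter. The ultraproduct of the models of the lists
    over an ultrafilter extending it satisfies each formula of [Gamma], by Los's theorem. *)
Lemma compactness (L : language) (T : theory L) (V : Type)
    (Gamma : set (formula L V)) :
  (forall l : seq {classic (formula L V)},
    (forall phi, phi \in l -> Gamma phi) ->
    exists (K : structure L) (v : V -> K),
      model T K /\ forall phi, phi \in l -> sat phi v) ->
  exists (K : structure L) (v : V -> K),
    model T K /\ forall phi, Gamma phi -> sat phi v.
Proof.
move=> fin_sat.
pose I := {l : seq {classic (formula L V)} | forall phi, phi \in l -> Gamma phi}.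
have exK (i : I) : exists K : structure L, exists v : V -> K,
    model T K /\ forall phi, phi \in sval i -> sat phi v.
  exact: fin_sat (svalP i).
pose K (i : I) := sval (cid (exK i)).
have exv (i : I) := svalP (cid (exK i)).
pose w (i : I) : V -> K i := sval (cid (exv i)).
have [Kmod Ksat] := all_and2 (fun i => svalP (cid (exv i))).
have neK i : exists x : K i, True by have [[x] _] := Kmod i; exists x.
pose K0 i : K i := sval (cid (neK i)).
pose B (i : I) : set I := [set j : I | {subset sval i <= sval j}].
have BF : Filter (filter_from setT B).
  have nilG phi : phi \in ([::] : seq {classic (formula L V)}) -> Gamma phi.
    by [].
  apply: filter_from_filter; first by exists (exist _ _ nilG).
  move=> i j _ _.
  have ij phi : phi \in sval i ++ sval j -> Gamma phi.
    by rewrite mem_cat => /orP[/(svalP i)|/(svalP j)].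
  exists (exist _ _ ij : I) => // k /= H.
  by split=> phi Hphi; apply: H; rewrite /= mem_cat Hphi ?orbT.
have BP : ProperFilter (filter_from setT B).
  by apply: filter_from_proper => i _; exists i.
have [U [FU BU]] := ultraFilterLemma BP.
exists (ultraproduct U K), (fun x => ultra_proj U (fun i => w i x)).
split=> [|phi Gphi].
  split; first exact: (inhabits (ultra_proj U K0)).
  move=> phi Tphi; have -> : of_void (ultraproduct U K) =
      fun x => ultra_proj U (fun i => of_void (K i) x).
    by apply: funext => -[].
  apply/(sat_ultraproduct FU K0); apply: (filterS _ (filterT : U setT)) => i _ /=.
  by have [_ /(_ _ Tphi)] := Kmod i.
apply/(sat_ultraproduct FU K0).
have Gphi1 psi : psi \in [:: phi : {classic (formula L V)}] -> Gamma psi.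
  by rewrite inE => /eqP ->.
have : U (B (exist _ _ Gphi1)) by apply: BU; exists (exist _ _ Gphi1).
by apply: filterS => i /= H; apply: Ksat; apply: H; rewrite inE.
Qed.

(** * Quantifier-free types and embeddings *)

(** Equality of quantifier-free types; equivalently, an isomorphism between the generated
    substructures matches the two tuples. *)
Definition qf_equiv (L : language) (M N : structure L) (V : Type)
    (v : V -> M) (w : V -> N) : Prop :=
  forall phi : formula L V, quantifier_free phi -> (sat phi v <-> sat phi w).

Definition sum_fun (V Z K : Type) (v : V -> K) (z : Z -> K) : V + Z -> K :=
  fun w => match w with inl x => v x | inr y => z y end.

Definition reindex (L : language) (n : nat) (V : Type) (b : 'I_n -> V)
    (phi : formula L ('I_n + unit)) : formula L (V + unit) :=
  rename (fun w => match w with inl k => inl (b k) | inr y => inr y end) phi.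

Lemma sat_reindex (L : language) (K : structure L) (n : nat) (V : Type)
    (b : 'I_n -> V) (phi : formula L ('I_n + unit)) (f : V -> K)
    (z : unit -> K) :
  sat (reindex b phi) (sum_fun f z) = sat phi (sum_fun (f \o b) z).
Proof. by rewrite sat_rename; congr sat; apply: funext => -[]. Qed.

(** Atomic formulas are equational, and quantifier-free formulas are Boolean combinations of
    them. *)
Lemma qf_equiv_equational (L : language) (M N : structure L) (V : Type)
    (v : V -> M) (w : V -> N) :
  (forall phi : formula L V, equational phi -> (sat phi v <-> sat phi w)) ->
  qf_equiv v w.
Proof.
move=> vw phi; elim: phi v w vw => //= {V}.
- by move=> V t u v w vw _; apply: (vw (Eq t u)).
- by move=> V r ts v w vw _; apply: (vw (Rel r ts)).
- by move=> V psi IH v w vw qf; rewrite (IH _ _ vw).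
- by move=> V psi IH chi IH' v w vw /andP[? ?]; rewrite (IH _ _ vw) ?(IH' _ _ vw).
- by move=> V psi IH chi IH' v w vw /andP[? ?]; rewrite (IH _ _ vw) ?(IH' _ _ vw).
Qed.

Lemma qf_equiv_sym (L : language) (M N : structure L) (V : Type)
    (v : V -> M) (w : V -> N) : qf_equiv v w -> qf_equiv w v.
Proof. by move=> vw phi /vw ->. Qed.

Lemma qf_equiv_trans (L : language) (M N K : structure L) (V : Type)
    (v : V -> M) (w : V -> N) (u : V -> K) :
  qf_equiv v w -> qf_equiv w u -> qf_equiv v u.
Proof. by move=> vw wu phi qf; rewrite vw // wu. Qed.

Lemma qf_equiv_comp (L : language) (M N : structure L) (V W : Type)
    (s : W -> V) (v : V -> M) (w : V -> N) :
  qf_equiv v w -> qf_equiv (v \o s) (w \o s).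
Proof.
move=> vw phi qf; rewrite -(sat_rename phi s v) -(sat_rename phi s w); apply: vw.
by rewrite quantifier_free_rename.
Qed.

Lemma qf_equiv_inj (L : language) (M N : structure L) (V : Type)
    (v : V -> M) (w : V -> N) (x y : V) :
  qf_equiv v w -> v x = v y -> w x = w y.
Proof. by move=> /(_ (Eq (Var x) (Var y)) erefl)[]. Qed.

Lemma emb_eval (L : language) (M N : structure L) (g : embedding M N)
    (V : Type) (v : V -> M) (t : term L V) :
  g (eval v t) = eval (g \o v) t.
Proof.
elim: t => [//|f ts IH] /=; rewrite emb_fint; congr fint.
by apply: funext => k /=.
Qed.

Lemma qf_equiv_emb (L : language) (M N : structure L) (g : embedding M N)
    (V : Type) (v : V -> M) : qf_equiv v (g \o v).
Proof.
apply: qf_equiv_equational => phi; elim: phi v => //= {V}.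
- move=> V t u v _; rewrite -!emb_eval; split=> [->//|]; exact: emb_inj.
- move=> V r ts v _; rewrite (emb_rint g).
  suff -> : (fun k => eval (g \o v) (ts k)) = g \o (fun k => eval v (ts k)) by [].
  by apply: funext => k /=; rewrite emb_eval.
- by move=> V psi IH chi IH' v /andP[/IH-> /IH'->].
- by move=> V psi IH chi IH' v /andP[/IH-> /IH'->].
Qed.

(** With every element of [M] as a variable, atomic formulas describe the operations and relations
    of [M] completely, and equations between variables give injectivity. *)
Lemma qf_equiv_embedding (L : language) (M N : structure L) (f : M -> N) :
  qf_equiv id f -> exists g : embedding M N, emb_fun g = f.
Proof.
move=> E.
have inj_f : injective f.
  by move=> x y; apply: (qf_equiv_inj (qf_equiv_sym E)).
have fint_f (F : func_sym L) (u : 'I_(farity F) -> M) :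
    f (fint u) = fint (f \o u).
  by have [/(_ erefl)/= <-] :=
    E (Eq (App F (fun k => Var (u k))) (Var (fint u))) erefl.
have rint_f (r : rel_sym L) (u : 'I_(rarity r) -> M) :
  rint u <-> rint (f \o u) by exact: (E (Rel r (fun k => Var (u k))) erefl).
by exists (Embedding inj_f fint_f rint_f).
Qed.

Lemma emb_id (L : language) (M : structure L) :
  exists g : embedding M M, emb_fun g = id.
Proof. exact: qf_equiv_embedding. Qed.

Lemma emb_comp (L : language) (M N K : structure L) (g : embedding N K)
    (f : embedding M N) : exists h : embedding M K, emb_fun h = g \o f.
Proof.
apply: qf_equiv_embedding.
exact: qf_equiv_trans (qf_equiv_emb f id) (qf_equiv_emb g _).
Qed.

(** * Finitely generated substructures *)

Lemma generated_eval (L : language) (M : structure L) (V : Type) (a : V -> M)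
    (x : M) : generated (range a) x -> exists t : term L V, eval a t = x.
Proof.
move=> /(_ [set y | exists t, eval a t = y]); apply.
split=> [f u /choice[ts Hts]|_ [y _ <-]]; last by exists (Var y).
by exists (App f ts) => /=; congr fint; apply: funext.
Qed.

(** Every element of the generated substructure is the value of a term at [a] and is sent to the
    value of that term at [b]. Both tuples satisfy the same equations, so the choice of the term
    does not matter. *)
Lemma gen_structure_embedding (L : language) (M K : structure L) (n : nat)
    (a : 'I_n -> M) (b : 'I_n -> K) :
  qf_equiv a b -> exists e : embedding (gen_structure (range a)) K,
    e \o @param_gen L M (range a) \o tuple_param a = b.
Proof.
move=> ab.
have /choice[tm tmE] (x : gen_structure (range a)) := generated_eval (svalP x).
have evE t x : eval a t = sval x -> eval b t = eval b (tm x).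
  move=> e; have [+ _] := ab (Eq t (tm x)) erefl; apply.
  by rewrite /= tmE.
pose f x := eval b (tm x).
have inj_f : injective f.
  move=> x y fxy; have [_ /(_ fxy)] := ab (Eq (tm x) (tm y)) erefl.
  by rewrite /= !tmE; case: x y {fxy} => x px [y py] /= e; apply: eq_exist.
have fint_f (F : func_sym L) (u : 'I_(farity F) -> gen_structure (range a)) :
    f (fint u) = fint (f \o u).
  rewrite /f -(evE (App F (tm \o u))) //=; congr fint.
  by apply: funext => k /=; rewrite tmE.
have rint_f (r : rel_sym L) (u : 'I_(rarity r) -> gen_structure (range a)) :
    rint u <-> rint (f \o u).
  have := ab (Rel r (tm \o u)) erefl => /= <-.
  by have -> : (fun k => eval a (tm (u k))) = sval \o u
    by apply: funext => k /=; rewrite tmE.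
exists (Embedding inj_f fint_f rint_f); apply: funext => k /=.
by rewrite /f -(evE (Var k)).
Qed.

Lemma gen_structure_inclusion (L : language) (M : structure L) (A : set M) :
  exists e : embedding (gen_structure A) M, emb_fun e = @sval M _.
Proof.
have inj_f : injective (sval : gen_structure A -> M).
  by move=> [x px] [y py] /= e; apply: eq_exist.
have fint_f (F : func_sym L) (u : 'I_(farity F) -> gen_structure A) :
  sval (fint u) = fint (sval \o u) by [].
have rint_f (r : rel_sym L) (u : 'I_(rarity r) -> gen_structure A) :
  rint u <-> rint (sval \o u) by [].
by exists (Embedding inj_f fint_f rint_f).
Qed.

Lemma gen_structure_qf_equiv (L : language) (M K : structure L) (n : nat)
    (a : 'I_n -> M) (e : embedding (gen_structure (range a)) K) :
  qf_equiv a (e \o @param_gen L M (range a) \o tuple_param a).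
Proof.
have [g gE] := gen_structure_inclusion (range a).
have := qf_equiv_emb g (@param_gen L M (range a) \o tuple_param a).
rewrite gE => /qf_equiv_sym /qf_equiv_trans; apply; exact: qf_equiv_emb.
Qed.

(** * Finite supports and compactness over a model *)

Definition supported (L : language) (V : Type) (phi : formula L V)
    (s : seq {classic V}) : Prop :=
  forall (K : structure L) (v w : V -> K),
    (forall x : V, (x : {classic V}) \in s -> v x = w x) ->
    (sat phi v <-> sat phi w).

Lemma eval_support (L : language) (V : Type) (t : term L V) :
  exists s : seq {classic V}, forall (K : structure L) (v w : V -> K),
    (forall x : V, (x : {classic V}) \in s -> v x = w x) ->
    eval v t = eval w t.
Proof.
elim: t => [x|f ts /choice[s Hs]].
  by exists [:: x : {classic V}] => K v w; apply; rewrite inE.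
exists (flatten [seq s k | k <- enum 'I_(farity f)]) => K v w vw /=.
congr fint; apply: funext => k; apply: Hs => x xs; apply: vw.
by apply/flatten_mapP; exists k; rewrite ?mem_enum.
Qed.

(** Arities are finite, so only finitely many variables occur. Support is defined semantically, by
    invariance of truth, and need not be minimal. *)
Lemma quantifier_free_support (L : language) (V : Type) (phi : formula L V) :
  quantifier_free phi -> exists s, supported phi s.
Proof.
elim: phi => //= {V}.
- by move=> V _; exists [::].
- by move=> V _; exists [::].
- move=> V t u _; have [s Hs] := eval_support t; have [s' Hs'] := eval_support u.
  exists (s ++ s') => K v w vw /=.
  rewrite (Hs _ v w) ?(Hs' _ v w) // => x xs; apply: vw;
    by rewrite mem_cat xs ?orbT.
- move=> V r ts _; have /choice[s Hs] k := eval_support (ts k).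
  exists (flatten [seq s k | k <- enum 'I_(rarity r)]) => K v w vw /=.
  suff -> : (fun k => eval v (ts k)) = (fun k => eval w (ts k)) by [].
  apply: funext => k; apply: Hs => x xs; apply: vw.
  by apply/flatten_mapP; exists k; rewrite ?mem_enum.
- by move=> V psi IH /IH[s Hs]; exists s => K v w vw /=; rewrite (Hs _ v w vw).
- move=> V psi IH chi IH' /andP[/IH[s Hs] /IH'[s' Hs']].
  exists (s ++ s') => K v w vw /=.
  rewrite (Hs _ v w) ?(Hs' _ v w) // => x xs; apply: vw;
    by rewrite mem_cat xs ?orbT.
- move=> V psi IH chi IH' /andP[/IH[s Hs] /IH'[s' Hs']].
  exists (s ++ s') => K v w vw /=.
  rewrite (Hs _ v w) ?(Hs' _ v w) // => x xs; apply: vw;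
    by rewrite mem_cat xs ?orbT.
Qed.

Lemma seq_tuple_retract (V : Type) (x0 : V) (s : seq {classic V}) :
  exists (n : nat) (b : 'I_n -> V) (r : V -> 'I_n),
    forall x : V, (x : {classic V}) \in s -> b (r x) = x.
Proof.
(* The last index serves the elements outside [s]: their index is [size s], where [nth] returns
   [x0]. *)
exists (size s).+1, (fun k => nth (x0 : {classic V}) s k).
exists (fun x => inord (index (x : {classic V}) s)) => x xs.
by rewrite inordK ?nth_index // ltnS ltnW // index_mem.
Qed.

(** This is a mere map of sets, with a default value outside the range of [b]. It suits
    [extension_compactness], whose finite instances control only finitely many elements. *)
Lemma qf_equiv_map (L : language) (M K : structure L) (V : Type) (b : V -> M)
    (b' : V -> K) :
  inhabited K -> qf_equiv b b' -> exists f : M -> K, f \o b = b'.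
Proof.
move=> [y0] bb'.
have /choice[f Hf] (x : M) : exists y : K, forall k, b k = x -> y = b' k.
  have [[k <-]|nk] := pselect (exists k, b k = x).
    by exists (b' k) => k' /(qf_equiv_inj bb') ->.
  by exists y0 => k e; case: nk; exists k.
by exists f; apply: funext => k /=; apply: Hf.
Qed.

(** Adding the quantifier-free diagram of [N] to [Delta] turns a satisfying valuation into an
    extension of [N]. A finite part of the diagram involves finitely many elements, so a finite
    instance only needs a map preserving the type of a finite tuple. *)
Lemma extension_compactness (L : language) (T : theory L) (N : structure L)
    (Z : Type) (Delta : set (formula L (N + Z))) :
  inhabited N ->
  (forall (n : nat) (b : 'I_n -> N) (l : seq {classic (formula L (N + Z))}),
    (forall phi, phi \in l -> Delta phi) ->
    exists (K : structure L) (f : N -> K) (z : Z -> K),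
      [/\ model T K, qf_equiv b (f \o b) &
          forall phi, phi \in l -> sat phi (sum_fun f z)]) ->
  exists (K : structure L) (g : embedding N K) (z : Z -> K),
    model T K /\ forall phi, Delta phi -> sat phi (sum_fun g z).
Proof.
move=> [x0] H.
pose diag (phi : formula L (N + Z)) (s : seq {classic N}) :=
  exists chi, [/\ phi = rename inl chi, quantifier_free chi,
                  sat chi (id : N -> N) & supported chi s].
pose Gamma := [set phi | Delta phi \/ exists s, diag phi s].
have [|K [v [Kmod Kv]]] := @compactness L T (N + Z) Gamma.
  move=> l lG.
  (* A single list [s] is found that supports the diagram formulas of [l]. *)
  have [s Hs] : exists s, forall phi, phi \in l -> Delta phi \/ diag phi s.
    elim: l lG => [|phi l IH] lG; first by exists [::].
    have [psi psil|s Hs] := IH; first by apply: lG; rewrite inE psil orbT.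
    have [|Dphi|[s' [chi [e qf sc supp]]]] := lG phi; first by rewrite inE eqxx.
      by exists s => psi; rewrite inE => /orP[/eqP->|/Hs]; [left|].
    exists (s' ++ s) => psi; rewrite inE => /orP[/eqP->|/Hs[|]].
    - right; exists chi; split=> // K v w vw; apply: supp => x xs.
      by apply: vw; rewrite mem_cat xs.
    - by left.
    - move=> [chi' [e' qf' sc' supp']]; right; exists chi'; split=> // K v w vw.
      by apply: supp' => x xs; apply: vw; rewrite mem_cat xs orbT.
  have [n [b [r brK]]] := seq_tuple_retract x0 s.
  have [|K [f [z [Kmod bf Kz]]]] := H n b [seq phi <- l | `[< Delta phi >]].
    by move=> phi; rewrite mem_filter => /andP[/asboolP].
  exists K, (sum_fun f z); split=> // phi phil.
  have [Dphi|[chi [-> qf sc supp]]] := Hs phi phil.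
    by apply: Kz; rewrite mem_filter phil andbT; apply/asboolP.
  (* The maps [f] and [f \o b \o r] agree on [s], so the truth of [chi] transfers through the tuple
     [b]. *)
  rewrite sat_rename; apply/(supp _ (f \o b \o r)).
    by move=> x xs /=; rewrite brK.
  by apply/(qf_equiv_comp r bf) => //; apply/(supp _ _ id) => // x /brK.
have [g gE] : exists g : embedding N K, emb_fun g = v \o inl.
  apply: qf_equiv_embedding => phi qf.
  have D chi : quantifier_free chi -> sat chi (id : N -> N) -> sat chi (v \o inl).
    move=> qf' sc; rewrite -sat_rename; apply: Kv; right.
    by have [s] := quantifier_free_support qf'; exists s, chi.
  split; first exact: D.
  by move=> sv; apply: contrapT => nsc; apply: (D (Not phi)).
exists K, g, (v \o inr); split=> // phi Dphi.
by rewrite gE (_ : sum_fun _ _ = v); [apply: Kv; left|apply: funext => -[]].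
Qed.

(** * The axioms of local Krull-minimality in terms of tuples *)

(** This is provability over [a], with the embedding of the substructure generated by [a] replaced
    by a tuple of the same quantifier-free type. Parameters become variables, so formulas can be
    moved between tuples. *)
Definition tuple_valid (L : language) (T : theory L) (M : structure L)
    (n : nat) (a : 'I_n -> M) (phi : formula L ('I_n + unit)) : Prop :=
  forall (K : structure L) (b : 'I_n -> K) (z : unit -> K),
    model T K -> qf_equiv a b -> sat phi (sum_fun b z).

Definition tuple_entails (L : language) (T : theory L) (M : structure L)
    (n : nat) (a : 'I_n -> M) (p : set (formula L ('I_n + unit)))
    (phi : formula L ('I_n + unit)) : Prop :=
  forall (K : structure L) (b : 'I_n -> K) (z : unit -> K),
    model T K -> qf_equiv a b -> (forall psi, p psi -> sat psi (sum_fun b z)) ->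
    sat phi (sum_fun b z).

Lemma sat_inst (L : language) (M K : structure L) (n : nat) (a : 'I_n -> M)
    (e : embedding (gen_structure (range a)) K) (z : unit -> K)
    (phi : formula L ('I_n + unit)) :
  sat (inst (tuple_param a) phi) (assign e z) =
  sat phi (sum_fun (e \o @param_gen L M (range a) \o tuple_param a) z).
Proof. by rewrite sat_rename; congr sat; apply: funext => -[]. Qed.

Lemma tuple_param_section (L : language) (M : structure L) (n : nat)
    (a : 'I_n -> M) :
  exists s : param (range a) -> 'I_n, cancel s (tuple_param a).
Proof.
suff /choice[s Hs] : forall c : param (range a), exists k, tuple_param a k = c.
  by exists s.
by move=> [x rx]; have [k _ kx] := rx; exists k; apply: eq_exist.
Qed.

(** The tuple [a] may have repetitions, so each parameter is replaced by the variable of one chosen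
    index at which it occurs. *)
Lemma formula_over_tuple (L : language) (M : structure L) (n : nat)
    (a : 'I_n -> M) (phi : formula_over (range a) unit) :
  exists psi : formula L ('I_n + unit), equational psi = equational phi /\
    forall (K : structure L) (e : embedding (gen_structure (range a)) K) z,
      sat phi (assign e z) =
      sat psi (sum_fun (e \o @param_gen L M (range a) \o tuple_param a) z).
Proof.
have [s sK] := tuple_param_section a.
exists (rename (fun w => match w with inl c => inl (s c) | inr x => inr x end) phi).
split=> [|K e z]; first exact: equational_rename.
rewrite sat_rename; congr sat; apply: funext => -[c|//] /=.
by rewrite sK.
Qed.

Lemma krull_D0 (L : language) (T : theory L) (M : structure L) (n : nat)
    (a : 'I_n -> M) (phi psi : formula L ('I_n + unit)) :
  locally_krull_minimal T -> model T M -> equational phi -> equational psi ->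
  tuple_valid T a (Or phi psi) -> tuple_valid T a phi \/ tuple_valid T a psi.
Proof.
move=> krull Mmod ephi epsi val; have [[_ D0] _ _ _] := krull M Mmod n a.
have back chi : entails T (@trivial_eq L M (range a)) (inst (tuple_param a) chi) ->
    tuple_valid T a chi.
  move=> ent K b z Kmod /gen_structure_embedding[e <-]; rewrite -sat_inst.
  by apply: ent => // _ ->.
case: (D0 (inst (tuple_param a) phi) (inst (tuple_param a) psi)).
- by rewrite equational_rename.
- by rewrite equational_rename.
- move=> K Kmod e z _ /=; rewrite !sat_inst; apply: val => //.
  exact: gen_structure_qf_equiv.
- by move/back; left.
- by move/back; right.
Qed.

(** Axiom (D2) is applied with all of [N] as the set [B]: a model containing the substructure
    generated by [N] is an extension of [N]. *)
Lemma krull_D2 (L : language) (T : theory L) (M N : structure L) (n : nat)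
    (a : 'I_n -> M) (b : 'I_n -> N) (x : unit -> M)
    (zeta : formula L ('I_n + unit)) :
  locally_krull_minimal T -> model T M -> model T N -> qf_equiv a b ->
  equational zeta -> sat zeta (sum_fun a x) ->
  exists (K : structure L) (g : embedding N K) (z : unit -> K),
    model T K /\ sat zeta (sum_fun (g \o b) z).
Proof.
move=> krull Mmod Nmod ab ezeta szeta; have [_ _ D2 _] := krull M Mmod n a.
have [e eb] := gen_structure_embedding ab.
have cons : consistent_type T [set inst (tuple_param a) zeta].
  have [g gE] := gen_structure_inclusion (range a).
  move=> /(_ M Mmod g x); apply => _ ->; rewrite sat_inst gE.
  exact: szeta.
have /existsNP[K /not_implyP[Kmod]] :=
  D2 zeta ezeta cons N Nmod e setT (fun=> I).
move=> /existsNP[e' /existsNP[z /contrapT /(_ _ erefl)]].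
rewrite sat_rename => sz.
have [h hE] : exists h : embedding N (gen_structure [set: N]),
    emb_fun h = fun x => param_gen (exist _ x I : param [set: N]).
  have inj_h : injective (fun x => param_gen (exist _ x I : param [set: N])).
    by move=> y y' /(congr1 sval).
  have fint_h (f : func_sym L) (u : 'I_(farity f) -> N) :
      param_gen (exist _ (fint u) I : param [set: N]) =
      @fint L (gen_structure [set: N]) f
        (fun k => param_gen (exist _ (u k) I : param [set: N])).
    exact: eq_exist.
  by exists (Embedding inj_h fint_h (fun r u => iff_refl (rint u))).
have [g gE] := emb_comp e' h.
exists K, g, z; split=> //; rewrite gE hE -eb.
by move: sz; congr (sat zeta _); apply: funext => -[].
Qed.

(* By compactness, the formula of a principal equational type may be taken    *)
(* equational; by maximality it determines the quantifier-free type.          *)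
Lemma krull_D3 (L : language) (T : theory L) (M : structure L) (n : nat)
    (a : 'I_n -> M) (p : set (formula L ('I_n + unit))) :
  locally_krull_minimal T -> model T M ->
  (forall phi, p phi -> equational phi) ->
  (exists x : unit -> M, forall phi, p phi -> sat phi (sum_fun a x)) ->
  (forall phi psi, equational phi -> equational psi ->
    tuple_entails T a p (Or phi psi) ->
    tuple_entails T a p phi \/ tuple_entails T a p psi) ->
  (exists2 phi, p phi & ~ tuple_valid T a phi) ->
  exists psi : formula L ('I_n + unit),
    [/\ equational psi,
        forall (K : structure L) (v : 'I_n + unit -> K),
          (forall phi, p phi -> sat phi v) -> sat psi v &
        forall (K1 K2 : structure L) (b1 : 'I_n -> K1) (b2 : 'I_n -> K2) z1 z2,
          model T K1 -> model T K2 -> qf_equiv a b1 -> qf_equiv a b2 ->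
          sat psi (sum_fun b1 z1) -> sat psi (sum_fun b2 z2) ->
          qf_equiv (sum_fun b1 z1) (sum_fun b2 z2)].
Proof.
move=> krull Mmod ep [x px] pp [phi0 pphi0 nval].
have [_ _ _ D3] := krull M Mmod n a.
pose q : type_over (range a) unit := [set inst (tuple_param a) phi | phi in p].
have qE K (e : embedding (gen_structure (range a)) K) z :
    realizes q (assign e z) <-> forall phi, p phi ->
      sat phi (sum_fun (e \o @param_gen L M (range a) \o tuple_param a) z).
  split=> [H phi pphi|H _ [phi pphi <-]]; last by rewrite sat_inst; apply: H.
  by rewrite -sat_inst; apply: H; exists phi.
have entE phi psi : (forall (K : structure L)
      (e : embedding (gen_structure (range a)) K) z, sat phi (assign e z) =
      sat psi (sum_fun (e \o @param_gen L M (range a) \o tuple_param a) z)) ->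
    entails T q phi <-> tuple_entails T a p psi.
  move=> H; split=> [ent K b z Kmod /gen_structure_embedding[e <-]|ent K Kmod e z].
    by move=> /qE; rewrite -H; apply: ent.
  by move=> /qE; rewrite H; apply: ent => //; apply: gen_structure_qf_equiv.
have [|||[_ maxq] [phi1 Hphi1]] := D3 q.
- by move=> _ [phi /ep ephi <-]; rewrite equational_rename.
- move=> triv; apply: nval => K b z Kmod /gen_structure_embedding[e <-].
  by have /qE := triv K Kmod e z; apply.
- split.
    have [g gE] := gen_structure_inclusion (range a).
    by move=> /(_ M Mmod g x); apply; apply/qE => phi; rewrite gE; apply: px.
  move=> phi psi ephi epsi.
  have [phi' [ephi' Hphi]] := formula_over_tuple phi.
  have [psi' [epsi' Hpsi]] := formula_over_tuple psi.
  move=> /(entE (Or phi psi) (Or phi' psi')) ent.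
  have [|||H|H] := pp phi' psi'; rewrite ?ephi' ?epsi' //.
  + by apply: ent => K e z /=; rewrite Hphi Hpsi.
  + by left; apply/(entE _ phi').
  + by right; apply/(entE _ psi').
have [chi1 [_ Hchi1]] := formula_over_tuple phi1.
have {phi1 Hphi1 Hchi1} chi1P (K : structure L) (b : 'I_n -> K) z :
    model T K -> qf_equiv a b ->
    (forall phi, p phi -> sat phi (sum_fun b z)) <-> sat chi1 (sum_fun b z).
  move=> Kmod /gen_structure_embedding[e <-].
  by rewrite -Hchi1 -qE; apply: Hphi1.
have [psi [epsi ppsi psichi1]] : exists psi : formula L ('I_n + unit),
    [/\ equational psi,
        forall (K : structure L) (v : 'I_n + unit -> K),
          (forall phi, p phi -> sat phi v) -> sat psi v &
        tuple_entails T a [set psi] chi1].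
  apply: contrapT => nopsi.
  (* [Gamma] says that the tuple has the quantifier-free type of [a], that [p] holds and that [chi1]
     fails, which is impossible. But if no [psi] worked, the conjunction of the formulas of [p] in a
     finite part would not entail [chi1], so every finite part would be satisfiable. *)
  pose Gamma : set (formula L ('I_n + unit)) := [set phi |
    [\/ p phi, phi = Not chi1 | exists chi,
      [/\ phi = rename inl chi, quantifier_free chi & sat chi a]]].
  have [l lG|K [v [Kmod Kv]]] := @compactness L T ('I_n + unit) Gamma.
    have [psi [epsi ppsi Hpsi]] : exists psi : formula L ('I_n + unit),
      [/\ equational psi,
        forall (K : structure L) (v : 'I_n + unit -> K),
          (forall phi, p phi -> sat phi v) -> sat psi v &
        forall (K : structure L) (b : 'I_n -> K) z, qf_equiv a b ->
          sat psi (sum_fun b z) -> ~ sat chi1 (sum_fun b z) ->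
          forall phi, phi \in l -> sat phi (sum_fun b z)].
      elim: l lG => [|phi l IH] lG; first by exists Top.
      have [phi' phi'l|psi [epsi ppsi Hpsi]] := IH.
        by apply: lG; rewrite inE phi'l orbT.
      have [|pphi|phiE|[chi [phiE qf sc]]] := lG phi; first by rewrite inE eqxx.
      - exists (And phi psi); split=> /=; first by rewrite ep.
          by move=> K v pv; split; [apply: pv|apply: ppsi].
        move=> K b z ab [sphi spsi] nchi phi'; rewrite inE => /orP[/eqP-> //|].
        exact: Hpsi.
      - exists psi; split=> // K b z ab spsi nchi phi'.
        by rewrite inE => /orP[/eqP->|]; [rewrite phiE|exact: Hpsi].
      - exists psi; split=> // K b z ab spsi nchi phi'.
        rewrite inE => /orP[/eqP->|]; last exact: Hpsi.
        by rewrite phiE sat_rename; apply/(ab _ qf).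
    apply: contrapT => nK; apply: nopsi; exists psi; split=> // K b z Kmod ab H.
    apply: contrapT => nchi; apply: nK; exists K, (sum_fun b z); split=> //.
    by apply: Hpsi => //; apply: H.
  have ab : qf_equiv a (v \o inl).
    have D chi : quantifier_free chi -> sat chi a -> sat chi (v \o inl).
      by move=> qf sc; rewrite -sat_rename; apply: Kv; apply: Or33; exists chi.
    move=> phi qf; split; first exact: D.
    by move=> sv; apply: contrapT => nsc; apply: (D (Not phi)).
  have vE : v = sum_fun (v \o inl) (v \o inr) by apply: funext => -[].
  have : ~ sat chi1 v by apply: (Kv (Not chi1)); apply: Or32.
  rewrite vE; apply; apply/chi1P => // phi pphi.
  by rewrite -vE; apply: Kv; apply: Or31.
exists psi; split=> // K1 K2 b1 b2 z1 z2 K1mod K2mod ab1 ab2 s1 s2.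
(* The formula [psi] entails [chi1], hence all of [p], and [p] decides every equational formula. *)
have pr (K : structure L) (b : 'I_n -> K) z :
    model T K -> qf_equiv a b -> sat psi (sum_fun b z) ->
    forall phi, p phi -> sat phi (sum_fun b z).
  by move=> Kmod ab spsi; apply/chi1P => //; apply: psichi1 => // _ ->.
apply: qf_equiv_equational => phi ephi.
have [|ent|ent] := maxq (inst (tuple_param a) phi).
- by rewrite equational_rename.
- have {}ent : tuple_entails T a p phi.
    by apply: (entE (inst (tuple_param a) phi) phi _).1 ent => K e z;
      exact: sat_inst.
  by split=> _; apply: ent => //; apply: pr.
- have {}ent : tuple_entails T a p (Not phi).
    apply: (entE (Not (inst (tuple_param a) phi)) (Not phi) _).1 ent => K e z /=.
    by rewrite sat_inst.
  by split=> s; exfalso; move: s; apply: ent => //; apply: pr.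
Qed.

(** * Amalgamation *)

(** Unlike in [tuple_valid], only extensions of the whole model [N] are considered, so more formulas
    may be valid. *)
Definition model_valid (L : language) (T : theory L) (N : structure L)
    (n : nat) (b : 'I_n -> N) (phi : formula L ('I_n + unit)) : Prop :=
  forall (K : structure L) (g : embedding N K) (z : unit -> K),
    model T K -> sat phi (sum_fun (g \o b) z).

(** If each formula fails in some extension of [N], neither is valid over any finite tuple [d] of
    [N] containing [b], so by (D0) some model refutes both at once over [d]. Compactness then yields
    one extension of [N] refuting both. *)
Lemma model_D0 (L : language) (T : theory L) (N : structure L) (n : nat)
    (b : 'I_n -> N) (phi psi : formula L ('I_n + unit)) :
  locally_krull_minimal T -> model T N -> equational phi -> equational psi ->
  model_valid T b (Or phi psi) -> model_valid T b phi \/ model_valid T b psi.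
Proof.
move=> krull Nmod ephi epsi val; apply: contrapT => /not_orP[nphi npsi].
pose Delta := [set Not (reindex b phi); Not (reindex b psi)].
have [|m c l lD|K [g [z [Kmod KD]]]] := @extension_compactness L T N unit Delta.
- exact: Nmod.1.
- pose d (k : 'I_(m + n)) := match split k with inl k => c k | inr k => b k end.
  have dl : d \o lshift n = c.
    by apply: funext => k; rewrite /d /= (unsplitK (inl k)).
  have dr : d \o @rshift m n = b.
    by apply: funext => k; rewrite /d /= (unsplitK (inr k)).
  pose up := @reindex L n _ (@rshift m n).
  have nup chi : ~ model_valid T b chi -> ~ tuple_valid T d (up chi).
    move=> nchi val'; apply: nchi => K g z Kmod.
    have := val' K (g \o d) z Kmod (qf_equiv_emb g d).
    by rewrite sat_reindex -dr.
  have : ~ tuple_valid T d (Or (up phi) (up psi)).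
    move=> /(krull_D0 krull Nmod); rewrite !equational_rename.
    by case=> //; apply: nup.
  move=> /existsNP[K /existsNP[d' /existsNP[z]]].
  move=> /not_implyP[Kmod /not_implyP[dd' nd']].
  have [f fd] := qf_equiv_map Kmod.1 dd'.
  exists K, f, z; split=> //.
    by rewrite -dl compA fd; apply: qf_equiv_comp.
  move: nd' => /= /not_orP[]; rewrite !sat_reindex -fd -compA dr.
  move=> n1 n2 chi /lD[] -> /=;
  by rewrite sat_reindex.
- have := val K g z Kmod; rewrite /= -!sat_reindex.
  by case; apply: (KD (Not _)); [left|right].
Qed.

(** * Realizing one-element types in extensions *)

Definition extends_type (L : language) (T : theory L) (M N : structure L)
    (n : nat) (a : 'I_n -> M) (b : 'I_n -> N) (x : unit -> M) : Prop :=
  exists (K : structure L) (g : embedding N K) (z : unit -> K),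
    model T K /\ qf_equiv (sum_fun a x) (sum_fun (g \o b) z).

(* The second alternative describes what happens when the type of x over a is *)
(* trivial but cannot be realized: the formulas valid in all extensions of N  *)
(* form a non-trivial prime type.                                             *)
Lemma extends_type_or (L : language) (T : theory L) (M N : structure L)
    (n : nat) (a : 'I_n -> M) (b : 'I_n -> N) (x : unit -> M) :
  locally_krull_minimal T -> model T M -> model T N -> qf_equiv a b ->
  extends_type T a b x \/
  exists psi : formula L ('I_n + unit),
    [/\ equational psi, model_valid T b psi &
        forall (K1 K2 : structure L) (b1 : 'I_n -> K1) (b2 : 'I_n -> K2) z1 z2,
          model T K1 -> model T K2 -> qf_equiv b b1 -> qf_equiv b b2 ->
          sat psi (sum_fun b1 z1) -> sat psi (sum_fun b2 z2) ->
          qf_equiv (sum_fun b1 z1) (sum_fun b2 z2)].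
Proof.
move=> krull Mmod Nmod ab.
have refl (K : structure L) (c : 'I_n -> K) : qf_equiv c c by [].
pose p := [set phi : formula L ('I_n + unit) |
  equational phi /\ sat phi (sum_fun a x)].
have [pnt|ptriv] := pselect (exists2 phi, p phi & ~ tuple_valid T a phi).
  left; have [||||psi [epsi ppsi Hpsi]] := @krull_D3 L T M n a p krull Mmod.
  - by move=> phi [].
  - by exists x => phi [].
  - move=> phi psi ephi epsi ent.
    (* The point [x] realizes [p] in [M], so it satisfies one of the disjuncts, which then belongs
       to [p]. *)
    have [|s|s] := ent M a x Mmod (refl _ _); first by move=> chi [].
      by left=> K c z Kmod ac; apply.
    by right=> K c z Kmod ac; apply.
  - exact: pnt.
  have spsi : sat psi (sum_fun a x) by apply: ppsi => chi [].
  have [K [g [z [Kmod sz]]]] := krull_D2 krull Mmod Nmod ab epsi spsi.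
  exists K, g, z; split=> //; apply: Hpsi => //.
  exact: qf_equiv_trans ab (qf_equiv_emb g b).
have {}ptriv phi : p phi -> tuple_valid T a phi.
  by move=> pphi; apply: contrapT => H; apply: ptriv; exists phi.
pose q := [set phi : formula L ('I_n + unit) |
  equational phi /\ model_valid T b phi].
have [qnt|qtriv] := pselect (exists2 phi, q phi & ~ tuple_valid T b phi).
  right; have [||||psi [epsi ppsi Hpsi]] := @krull_D3 L T N n b q krull Nmod.
  - by move=> phi [].
  - have [[y0] _] := Nmod; exists (fun=> y0) => phi [_ val].
    have [g gE] := emb_id N.
    by have := val N g (fun=> y0) Nmod; rewrite gE.
  - move=> phi psi ephi epsi ent.
    have /(model_D0 krull Nmod ephi epsi)[] : model_valid T b (Or phi psi).
    + move=> K g z Kmod; apply: ent => //; first exact: qf_equiv_emb.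
      by move=> chi [_]; apply.
    + by move=> val; left=> K c z Kmod bc; apply.
    + by move=> val; right=> K c z Kmod bc; apply.
  - exact: qnt.
  exists psi; split=> // K g z Kmod; apply: ppsi => chi [_]; exact.
(* An equational formula valid in all extensions of [N] is now valid over [b], hence over [a], hence
   true at [x]. *)
left; have {}qtriv phi : equational phi -> ~ sat phi (sum_fun a x) ->
    ~ model_valid T b phi.
  move=> ephi nphi val; apply: qtriv; exists phi => // val'; apply: nphi.
  by apply: val' => //; apply: qf_equiv_sym.
pose Delta := [set Not (reindex b phi) | phi in
  [set phi | equational phi /\ ~ sat phi (sum_fun a x)]].
have [|m c l lD|K [g [z [Kmod KD]]]] := @extension_compactness L T N unit Delta.
- exact: Nmod.1.
(* The equational formulas negated in [l] are joined into one disjunction [phi], false at [x]; an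
   extension of [N] refuting [phi] refutes them all. *)
- have [phi [ephi nphi Hphi]] : exists phi : formula L ('I_n + unit),
      [/\ equational phi, ~ sat phi (sum_fun a x) &
        forall (K : structure L) (f : N -> K) z,
          ~ sat phi (sum_fun (f \o b) z) ->
          forall chi, chi \in l -> sat chi (sum_fun f z)].
    elim: l lD => [|chi l IH] lD; first by exists Bot; split=> // [[]].
    have [chi' chi'l|phi [ephi nphi Hphi]] := IH.
      by apply: lD; rewrite inE chi'l orbT.
    have [|psi [epsi npsi] psichi] := lD chi; first by rewrite inE eqxx.
    exists (Or psi phi); split=> /=; first by rewrite epsi.
      by case.
    move=> K f z /not_orP[ns1 ns2] chi'; rewrite inE => /orP[/eqP ->|].
      by rewrite -psichi /= sat_reindex.
    exact: Hphi.
  have /existsNP[K /existsNP[g /existsNP[z /not_implyP[Kmod nz]]]] :=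
    qtriv phi ephi nphi.
  by exists K, g, z; split=> //; [apply: qf_equiv_emb|apply: Hphi].
- exists K, g, z; split=> //; apply: qf_equiv_equational => phi ephi.
  have [s|ns] := pselect (sat phi (sum_fun a x)).
    (* Equational formulas true at [x] belong to [p], which is trivial here. *)
    split=> // _; apply: ptriv => //.
    exact: qf_equiv_trans ab (qf_equiv_emb g b).
  split=> // s; have : sat (Not (reindex b phi)) (sum_fun g z).
    by apply: KD; exists phi.
  by rewrite /= sat_reindex.
Qed.

(** The second alternative of [extends_type_or] would give the first entry of [b] and another point
    of an infinite extension of [N] the same quantifier-free type over [b], but equality with that
    entry separates them. *)
Lemma extends_type_pos (L : language) (T : theory L) (M N : structure L)
    (n : nat) (a : 'I_n.+1 -> M) (b : 'I_n.+1 -> N) (x : unit -> M) :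
  extends_to_infinite T -> locally_krull_minimal T ->
  model T M -> model T N -> qf_equiv a b -> extends_type T a b x.
Proof.
move=> Tinf krull Mmod Nmod ab.
have [//|[psi [epsi val Hpsi]]] := extends_type_or x krull Mmod Nmod ab.
have [K [Kmod Kinf [g]]] := Tinf N Nmod.
have [y yb] : exists y : K, y <> g (b ord0).
  apply: contrapT => /forallNP nK; apply: Kinf.
  have -> : [set: K] = [set g (b ord0)].
    by apply/seteqP; split=> // y _; apply: contrapT => /nK.
  exact: finite_set1.
have gb := qf_equiv_emb g b.
have E := Hpsi K K _ _ (fun=> g (b ord0)) (fun=> y) Kmod Kmod gb gb
  (val _ _ _ Kmod) (val _ _ _ Kmod).
by case: yb; apply/esym/(qf_equiv_inj (x := inl ord0) (y := inr tt) E).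
Qed.

Lemma extends_typeP (L : language) (T : theory L) (M N : structure L)
    (n : nat) (a : 'I_n -> M) (b : 'I_n -> N) (x : unit -> M) :
  extends_to_infinite T -> locally_krull_minimal T ->
  model T M -> model T N -> qf_equiv a b -> extends_type T a b x.
Proof.
case: n a b => [|n] a b Tinf krull Mmod Nmod ab; last exact: extends_type_pos.
have [//|[psi [epsi val Hpsi]]] := extends_type_or x krull Mmod Nmod ab.
(* Over the empty tuple no equation x = a_0 is available, so first realize    *)
(* psi in an extension of M: this matches an element of N with one of M.      *)
have [[y0] _] := Nmod.
have [id_N id_NE] := emb_id N.
have s0 : sat psi (sum_fun b (fun=> y0)).
  by have := val N id_N (fun=> y0) Nmod; rewrite id_NE.
have [K [h [z [Kmod sz]]]] :=
  krull_D2 krull Nmod Mmod (qf_equiv_sym ab) epsi s0.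
(* Since [psi] determines the type, [z] in [K] and [y0] in [N] have the same quantifier-free type;
   they serve as one-element tuples. *)
have E : qf_equiv (sum_fun (h \o a) z) (sum_fun b (fun=> y0)).
  apply: Hpsi => //; exact: qf_equiv_trans (qf_equiv_sym ab) (qf_equiv_emb h a).
have E1 := qf_equiv_comp (fun _ : 'I_1 => inr tt) E.
have [K' [g [z' [K'mod E']]]] :=
  extends_type_pos (h \o x) Tinf krull Kmod Nmod E1.
exists K', g, z'; split=> //.
apply: qf_equiv_trans (qf_equiv_emb h _) _.
(* The matched element is forgotten again, to return to the empty tuple. *)
have := qf_equiv_comp (fun w : 'I_0 + unit => match w with
  inl k => inl (widen_ord (leq0n 1) k) | inr y => inr y end) E'.
congr (qf_equiv _ _); apply: funext => -[[]|] //.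
Qed.

(** The elements of [s] are added to the tuple one by one, each step extending [N]. The last clause
    says that [c] and [d] contain [a] and [g \o b] at matching positions, without fixing which
    ones. *)
Lemma extends_tuple (L : language) (T : theory L) (M : structure L)
    (s : seq {classic M}) (N : structure L) (n : nat)
    (a : 'I_n -> M) (b : 'I_n -> N) :
  extends_to_infinite T -> locally_krull_minimal T ->
  model T M -> model T N -> qf_equiv a b ->
  exists (K : structure L) (g : embedding N K) (m : nat) (c : 'I_m -> M)
    (d : 'I_m -> K),
    [/\ model T K, qf_equiv c d,
        forall x, x \in s -> exists k, c k = x &
        forall k, exists2 k', c k' = a k & d k' = g (b k)].
Proof.
move=> Tinf krull Mmod; elim: s N n a b => [|x s IH] N n a b Nmod ab.
  have [g gE] := emb_id N.
  by exists N, g, n, a, b; split=> // k; exists k; rewrite ?gE.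
have [K [g [z [Kmod E]]]] := extends_typeP (fun=> x) Tinf krull Mmod Nmod ab.
pose r (k : 'I_n.+1) : 'I_n + unit :=
  if unlift ord_max k is Some k' then inl k' else inr tt.
have [K' [g' [m [c [d [K'mod cd cs cdP]]]]]] :=
  IH _ _ _ _ Kmod (qf_equiv_comp r E).
have [h hE] := emb_comp g' g.
exists K', h, m, c, d; split=> //.
  move=> y; rewrite inE => /orP[/eqP->|/cs//].
  by have [k ck _] := cdP ord_max; exists k; rewrite ck /= /r unlift_none.
move=> k; have [k' ck' dk'] := cdP (lift ord_max k); exists k'.
  by rewrite ck' /= /r liftK.
by rewrite dk' hE /= /r liftK.
Qed.

Theorem theorem2p11 (L : language) (T : theory L)
    (T_consistent : consistent_theory T)
    (T_infinite : extends_to_infinite T)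
    (T_complete : complete_qf T)
    (T_krull : locally_krull_minimal T)
    (M N A : structure L) (M_model : model T M) (N_model : model T N)
    (i : embedding A M) (j : embedding A N) :
  exists N' : structure L, model T N' /\
    exists (g : embedding N N') (f : embedding M N'),
      forall c : A, f (i c) = g (j c).
Proof.
(* Compactness is applied to extensions of [M], with the elements of [N] as further variables.
   [diag] makes their values an embedded copy of [N], and [glue] identifies the two images of each
   element of [A]. *)
pose diag (phi : formula L (M + N)) := exists chi,
  [/\ phi = rename inr chi, quantifier_free chi & sat chi (id : N -> N)].
pose glue (c : A) : formula L (M + N) := Eq (Var (inl (i c))) (Var (inr (j c))).
pose Delta : set (formula L (M + N)) :=
  [set phi | diag phi \/ exists c, phi = glue c].
have [|n b l lD|K [f [z [Kmod KD]]]] := @extension_compactness L T M N Delta.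
- exact: M_model.1.
(* Only finitely many elements of [A] occur in the gluing equations of [l]; they are collected in
   [t]. *)
- have [t tP] : exists t : seq {classic A}, forall phi, phi \in l ->
      diag phi \/ exists2 c : {classic A}, c \in t & phi = glue c.
    elim: l lD => [|phi l IH] lD; first by exists [::].
    have [psi psil|t tP] := IH; first by apply: lD; rewrite inE psil orbT.
    have [|dphi|[c phiE]] := lD phi; first by rewrite inE eqxx.
      by exists t => psi; rewrite inE => /orP[/eqP->|/tP]; [left|].
    exists ((c : {classic A}) :: t) => psi; rewrite inE => /orP[/eqP->|/tP[|]].
    + by right; exists c; rewrite ?inE ?eqxx.
    + by left.
    + by case=> c' c't ->; right; exists c'; rewrite // inE c't orbT.
  pose u : 'I_(size t) -> A := tnth (in_tuple t).
  have iju : qf_equiv (i \o u) (j \o u).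
    exact: qf_equiv_trans (qf_equiv_sym (qf_equiv_emb i u)) (qf_equiv_emb j u).
  (* The images of [u] already have the same type in both models; extending [N] matches the entries
     of [b] as well. *)
  have [K [g [m [c [d [Kmod cd cs cdP]]]]]] :=
    extends_tuple [seq b k : {classic M} | k <- enum 'I_n]
      T_infinite T_krull M_model N_model iju.
  have [f fc] := qf_equiv_map Kmod.1 cd.
  exists K, f, g; split=> //.
    have /choice[r cr] k : exists k', c k' = b k.
      by apply: cs; apply/mapP; exists k; rewrite ?mem_enum.
    have -> : b = c \o r by apply: funext => k /=; rewrite cr.
    by rewrite compA fc; apply: qf_equiv_comp.
  move=> phi /tP[[chi [-> qf sc]]|[c' /(tnthP (in_tuple t))[k c'E] ->]].
    by rewrite sat_rename; apply/(qf_equiv_emb g id).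
  have [k' ck' dk'] := cdP k.
  by rewrite /= c'E -[LHS]/(f ((i \o u) k)) -ck' -[LHS]/((f \o c) k') fc dk'.
- have [g gE] : exists g : embedding N K, emb_fun g = z.
    have D chi : quantifier_free chi -> sat chi (id : N -> N) -> sat chi z.
      move=> qf sc.
      have : sat (rename inr chi) (sum_fun f z) by apply: KD; left; exists chi.
      by rewrite sat_rename.
    apply: qf_equiv_embedding => phi qf; split; first exact: D.
    by move=> sz; apply: contrapT => nsc; apply: (D (Not phi)).
  exists K; split=> //; exists g, f => c.
  by rewrite gE; apply: (KD (glue c)); right; exists c.
Qed.
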